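(* Let $G$ be a finite group with a unique nonlinear irreducible character $\phi$ and with $Z(G)=\{1\}$, and let $p^m$ be the prime power with $|G|=p^m(p^m-1)$ and $|G'|=p^m$. If $n\ge 3$, then $$C^{w_n}(\phi)=\frac{|G|^{n-1}}{|G'|}+\frac{|G|}{p^m-1}\,C^{w_{n-1}}(\phi)\,(p^m-2),$$ and hence $$\zeta^{w_n}_G=|G|^{n-1}\sum_{\chi\in\mathrm{lin}(G)}\chi+\frac{|G|}{p^m-1}\,C^{w_n}(\phi)\,\phi .$$
   Context: $[a,b]=a^{-1}b^{-1}ab$; $w_2(x_1,x_2)=[x_1,x_2]$ and $w_n(x_1,\dots,x_n)=[w_{n-1}(x_1,\dots,x_{n-1}),x_n]$ for $n\ge 3$. $\zeta^{w_n}_G(g)=|\{(a_1,\dots,a_n)\in G^n: w_n(a_1,\dots,a_n)=g\}|$. For an irreducible complex character $\chi$ of $G$: $C^{w_2}(\chi)=1$ and $C^{w_n}(\chi)=\langle\zeta^{w_{n-1}}_G\chi,\chi\rangle$ for $n\ge3$, where $\langle\alpha,\beta\rangle=\frac1{|G|}\sum_{g\in G}\alpha(g)\overline{\beta(g)}$. $\mathrm{lin}(G)$ is the set of linear characters, $G'=[G,G]$. By a known theorem (Berkovich–Chillag–Herzog), a finite group with a unique nonlinear irreducible character and trivial center is a Frobenius group of order $p^m(p^m-1)$ for some prime power $p^m$, with abelian Frobenius kernel $G'$ of order $p^m$ and cyclic Frobenius complement; this defines $p^m$. *)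

(* Defs.v *)
From HB Require Import structures.
From mathcomp Require Import all_boot all_order all_algebra.
From mathcomp Require Import all_fingroup all_solvable all_field all_character.

Set Implicit Arguments.
Unset Strict Implicit.
Unset Printing Implicit Defensive.

Import Order.TTheory GRing.Theory Num.Theory.

Local Open Scope group_scope.

(* The left-normed commutator [...[[x_1, x_2], x_3], ..., x_n], that is w_n for *)
(* n = size s; note that [~ x, y] is x^-1 * y^-1 * x * y (lemma w_pair below).  *)
Definition w (gT : finGroupType) (s : seq gT) : gT :=
  if s is x :: s' then foldl (fun u v => [~ u, v]) x s' else 1.

Lemma w_pair (gT : finGroupType) (x y : gT) :
  w [:: x; y] = x^-1 * y^-1 * x * y.
Proof. by rewrite /w /= /commg /conjg !mulgA. Qed.

Lemma w_rcons (gT : finGroupType) (s : seq gT) (x : gT) :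
  s != [::] -> w (rcons s x) = [~ w s, x].
Proof. by case: s => //= y s _; rewrite foldl_rcons. Qed.

Lemma w_in (gT : finGroupType) (G : {group gT}) (s : seq gT) :
  all [in G] s -> w s \in G.
Proof.
elim/last_ind: s => [|s x IHs] //=.
rewrite all_rcons => /andP[/= Gx Gs].
have [->|s_n0] := eqVneq s [::]; first by [].
by rewrite w_rcons // groupR ?IHs.
Qed.

Lemma w_conj (gT : finGroupType) (s : seq gT) (z : gT) :
  w [seq x ^ z | x <- s] = w s ^ z.
Proof.
elim/last_ind: s => [|s x IHs]; first by rewrite /= conj1g.
have [->|s_n0] := eqVneq s [::]; first by [].
by rewrite map_rcons !w_rcons ?IHs ?conjRg //; case: (s) s_n0.
Qed.

Definition w_sols (gT : finGroupType) (G : {group gT}) (n : nat) (g : gT) :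
  {set n.-tuple gT} := [set a : n.-tuple gT | all [in G] a & w a == g].

Fact zeta_class_fun (gT : finGroupType) (G : {group gT}) (n : nat) :
  is_class_fun <<G>> [ffun g => (#|w_sols G n g|%:R : algC)%R].
Proof.
rewrite genGid; apply: intro_class_fun => [x y Gx Gy | x notGx].
  congr (_%:R)%R.
  pose h (a : n.-tuple gT) := [tuple of [seq z ^ y | z <- a]].
  have h_inj : injective h.
    move=> a b /(congr1 val) /= /(inj_map (conjg_inj y)); exact: val_inj.
  rewrite -[RHS](card_imset _ h_inj); congr #|pred_of_set _|; apply/setP=> b.
  apply/idP/imsetP => [|[a] ].
    rewrite inE => /andP[Gb /eqP wb].
    exists [tuple of [seq z ^ y^-1 | z <- b]]; last first.
      by apply: val_inj; rewrite /= -map_comp map_id_in // => z _ /=; rewrite conjgKV.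
    rewrite inE /= w_conj wb conjgK eqxx andbT all_map.
    by apply/allP=> z /(allP Gb) /= Gz; rewrite groupJ ?groupV.
  rewrite inE => /andP[Ga /eqP wa] ->.
  rewrite inE /= w_conj wa eqxx andbT all_map.
  by apply/allP=> z /(allP Ga) /= Gz; rewrite groupJ.
suff -> : w_sols G n x = set0 by rewrite cards0.
apply/setP=> a; rewrite !inE; apply/negP=> /andP[Ga /eqP wa].
by rewrite -wa w_in in notGx.
Qed.

Definition zeta (gT : finGroupType) (G : {group gT}) (n : nat) : 'CF(G) :=
  Cfun 0 (zeta_class_fun G n).

Lemma zetaE (gT : finGroupType) (G : {group gT}) (n : nat) (g : gT) :
  zeta G n g = (#|[set a : n.-tuple gT | all [in G] a & w a == g]|%:R)%R.
Proof. by rewrite cfunE. Qed.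

(* C^{w_n}(chi); only the values for 2 <= n are meaningful. *)
Definition Cw (gT : finGroupType) (G : {group gT}) (n : nat) (chi : 'CF(G)) :
  algC := if (n <= 2)%N then 1%R else '[zeta G n.-1 * chi, chi]%R.

(* Main.v *)
Require Import Defs.
From HB Require Import structures.
From mathcomp Require Import all_boot all_order all_algebra.
From mathcomp Require Import all_fingroup all_solvable all_field all_character.
From mathcomp Require Import ring.

Set Implicit Arguments.
Unset Strict Implicit.
Unset Printing Implicit Defensive.

Import Order.TTheory GRing.Theory Num.Theory.

Local Open Scope ring_scope.

(* Since w_{n+1} = [w_n, x], <zeta_{n+1}, chi> is obtained by averaging
   chi([a, x]) over x in G with weight zeta_n(a), so everything reduces to
   sum_x chi([a, x]) = |G| / chi(1) * |chi(a)|^2.  For linear chi both sides are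
   |G|.  For phi, [a, x] lies in G', where the regular character forces
   phi(1) phi = |G| 1_{1} - |G : G'|; so the sum only depends on |C_G(a)|, which
   is |G : G'| + |phi(a)|^2 by the second orthogonality relation.  The recursion
   for C^{w_n}(phi) then follows from chi phi = phi (chi linear) and
   <phi^2, phi> = p^m - 2. *)

Lemma sum_zeta (gT : finGroupType) (G : {group gT}) (n : nat) (F : gT -> algC) :
  \sum_(g in G) zeta G n g * F g
    = \sum_(t : n.-tuple gT | all [in G] t) F (w t).
Proof.
rewrite (partition_big (fun t : n.-tuple gT => w t) [in G]) /=; last first.
  by move=> t; apply: w_in.
apply: eq_bigr => g _; rewrite zetaE mulr_natl.
rewrite (eq_bigr (fun=> F g)) => [|t /andP[_ /eqP->] //].
by rewrite sumr_const cardsE.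
Qed.

(** Splitting off the last entry [x] of a tuple turns [w] into [[~ w s, x]]. [F] is arbitrary so
    that it can be the conjugate of a character or the constant 1. *)
Lemma sum_zetaS (gT : finGroupType) (G : {group gT}) (n : nat)
    (F : gT -> algC) :
  \sum_(g in G) zeta G n.+2 g * F g
    = \sum_(a in G) zeta G n.+1 a * \sum_(x in G) F [~ a, x]%g.
Proof.
rewrite !sum_zeta pair_big /=.
pose h (u : n.+1.-tuple gT * gT) := [tuple of rcons u.1 u.2].
pose h' (t : n.+2.-tuple gT) :=
  ([tuple of belast (thead t) (behead_tuple t)], last (thead t) (behead t)).
have hK : cancel h h'.
  case=> t x; rewrite /h' /h /=; congr pair.
    apply: val_inj; rewrite /= /thead (tnth_nth x) /=.
    by case: t => -[|y t] //= _; rewrite belast_rcons.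
  rewrite /thead (tnth_nth x) /=.
  by case: t => -[|y t] //= _; rewrite last_rcons.
have h'K : cancel h' h.
  move=> t; apply: val_inj; rewrite /= -lastI.
  by case/tupleP: t => y t; rewrite theadE.
rewrite (reindex h) /=; last by exists h' => t _; [apply: hK | apply: h'K].
apply: eq_big => [[t x] | [t x] _] /=; first by rewrite all_rcons andbC.
by rewrite w_rcons //; case: t => -[].
Qed.

Lemma zeta1 (gT : finGroupType) (G : {group gT}) : zeta G 1 = 1.
Proof.
apply/cfunP=> g; rewrite zetaE cfun1E.
have [Gg | notGg] := boolP (g \in G).
  suff -> : [set a : 1.-tuple gT | all [in G] a & w a == g] = [set [tuple g]].
    by rewrite cards1.
  apply/setP=> a; rewrite !inE; case/tupleP: a => x t; rewrite tuple0 /= andbT.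
  rewrite -val_eqE /= eqseq_cons andbT.
  by case: eqP => [->|]; rewrite ?Gg ?andbF.
suff -> : [set a : 1.-tuple gT | all [in G] a & w a == g] = set0.
  by rewrite cards0.
apply/setP=> a; rewrite !inE; apply/negP=> /andP[/w_in Ga /eqP wa].
by rewrite -wa Ga in notGg.
Qed.

(* The convention C^{w_2} = 1 fits the general formula because zeta_1 = 1. *)
Lemma Cw_zeta (gT : finGroupType) (G : {group gT}) (n : nat) (chi : 'CF(G)) :
  chi \in irr G -> Cw n.+2 chi = '[zeta G n.+1 * chi, chi].
Proof.
move=> /irrP[i ->]; rewrite /Cw; case: n => [|n] //=.
by rewrite zeta1 mul1r cfdot_irr eqxx.
Qed.

(** [c] has to be real because [chi] sits in the conjugated slot of the inner product. *)
Lemma cfdot_zeta_commg (gT : finGroupType) (G : {group gT}) (n : nat)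
    (chi : 'CF(G)) (c : algC) :
  {in G, forall a, \sum_(x in G) chi [~ a, x]%g = c * `|chi a| ^+ 2} ->
  c \is Num.real ->
  '[zeta G n.+2, chi] = c * '[zeta G n.+1 * chi, chi].
Proof.
move=> sum_chi /CrealP c_real.
rewrite !cfdotE (sum_zetaS _ _ (fun g => (chi g)^*)) mulrCA; congr (_ * _).
rewrite mulr_sumr; apply: eq_bigr => a Ga.
rewrite -rmorph_sum sum_chi // rmorphM /= c_real rmorphXn /= conj_normC.
by rewrite !cfunE normCK; ring.
Qed.

Lemma sum_zeta1 (gT : finGroupType) (G : {group gT}) (n : nat) :
  \sum_(g in G) zeta G n.+1 g = #|G|%:R ^+ n.+1.
Proof.
elim: n => [|n IHn].
  rewrite zeta1 (eq_bigr (fun=> 1)) => [|g Gg]; first by rewrite sumr_const.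
  by rewrite cfun1E Gg.
rewrite exprSr -IHn mulr_suml -(sumr_const [in G] 1) -(sum_zetaS G n (fun=> 1)).
by apply: eq_bigr => g _; rewrite mulr1.
Qed.

Lemma cfdot_zeta_lin (gT : finGroupType) (G : {group gT}) (n : nat)
    (chi : 'CF(G)) :
  chi \is a linear_char -> '[zeta G n.+2, chi] = #|G|%:R ^+ n.+1.
Proof.
move=> chi_lin.
rewrite (@cfdot_zeta_commg _ _ _ _ #|G|%:R) ?realn //; last first.
  move=> a Ga; rewrite normC_lin_char // expr1n mulr1 -sumr_const.
  apply: eq_bigr => x Gx; rewrite -(lin_char1 chi_lin); apply: cfker1.
  by rewrite (subsetP (lin_char_der1 chi_lin)) // derg1 mem_commg.
(* The factor [#|G|] cancels the averaging, and [chi] has modulus 1 on [G], so only the total mass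
   of [zeta G n.+1] remains. *)
rewrite cfdotE mulVKf ?neq0CG // -sum_zeta1; apply: eq_bigr => g Gg.
by rewrite cfunE -mulrA -normCK normC_lin_char // expr1n mulr1.
Qed.

Section UniqueNonlinear.

Variables (gT : finGroupType) (G : {group gT}) (phi : 'CF(G)).
Hypotheses (phi_irr : phi \in irr G) (phi_nonlin : phi \isn't a linear_char).
Hypothesis phi_uniq : forall chi : 'CF(G),
  chi \in irr G -> chi \isn't a linear_char -> chi = phi.

(** [F] takes characters rather than indices, so that [phi] needs no index. *)
Lemma sum_Iirr_unique_nonlin (V : nmodType) (F : 'CF(G) -> V) :
  \sum_(i : Iirr G) F 'chi_i
    = \sum_(i : Iirr G | 'chi_i \is a linear_char) F 'chi_i + F phi.
Proof.
have /irrP[i0 def_phi] := phi_irr.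
rewrite (bigID (fun i : Iirr G => 'chi_i \is a linear_char)) /=; congr (_ + _).
rewrite (big_pred1 i0) ?def_phi // => i /=.
apply/idP/eqP => [nl_i | ->]; last by rewrite -def_phi.
by apply: irr_inj; rewrite -def_phi; apply: phi_uniq; rewrite ?mem_irr.
Qed.

(** The product is irreducible of the same degree as [phi], hence again nonlinear. *)
Lemma lin_mul_unique_nonlin (xi : 'CF(G)) :
  xi \is a linear_char -> xi * phi = phi.
Proof.
move=> xi_lin; apply: phi_uniq; first exact: mul_lin_irr.
apply: contra phi_nonlin; rewrite !qualifE /= => /andP[_].
rewrite cfunE (lin_char1 xi_lin) mul1r => ->; rewrite andbT.
by have /irrP[i ->] := phi_irr; apply: irr_char.
Qed.

Lemma conj_unique_nonlin : (phi^*)%CF = phi.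
Proof.
apply: phi_uniq; last by rewrite cfConjC_lin_char.
by have /irrP[i ->] := phi_irr; rewrite cfAut_irr mem_irr.
Qed.

(** In the regular character at [g], each of the |G : G'| linear characters contributes 1, since G'
    lies in its kernel. *)
Lemma unique_nonlin_der1 (g : gT) :
  g \in (G^`(1))%g ->
  phi 1%g * phi g = #|G|%:R *+ (g == 1%g) - #|G : G^`(1)|%g%:R.
Proof.
move=> G'g; rewrite -cfRegE cfReg_sum.
rewrite (sum_Iirr_unique_nonlin (fun chi => chi 1%g *: chi)) cfunE sum_cfunE.
rewrite cfunE (eq_bigr (fun=> 1)); last first.
  move=> i lin_i; rewrite cfunE (lin_char1 lin_i) mul1r.
  by rewrite cfker1 ?(lin_char1 lin_i) // (subsetP (lin_char_der1 lin_i)).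
by rewrite sumr_const card_lin_irr addrAC subrr add0r.
Qed.

Lemma card_cent1_unique_nonlin (a : gT) :
  a \in G -> #|'C_G[a]%g|%:R = #|G : G^`(1)|%g%:R + `|phi a| ^+ 2.
Proof.
move=> Ga; have := second_orthogonality_relation a Ga.
rewrite class_refl mulr1n => <-.
rewrite (sum_Iirr_unique_nonlin (fun chi => chi a * (chi a)^*)) -normCK.
congr (_ + _).
rewrite (eq_bigr (fun=> 1)) ?sumr_const ?card_lin_irr // => i lin_i.
by rewrite -normCK normC_lin_char // expr1n.
Qed.

Lemma unique_nonlin_sum_commg (a : gT) : a \in G ->
  phi 1%g * \sum_(x in G) phi [~ a, x]%g = #|G|%:R * `|phi a| ^+ 2.
Proof.
move=> Ga; rewrite mulr_sumr.
rewrite (eq_bigr (fun x => #|G|%:R *+ ([~ a, x]%g == 1%g)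
                           - #|G : G^`(1)|%g%:R)) => [|x Gx]; last first.
  by rewrite unique_nonlin_der1 // derg1 mem_commg.
rewrite sumrB sumr_const.
(* The commutator is trivial exactly when [x] centralizes [a]. *)
have -> : \sum_(x in G) #|G|%:R *+ ([~ a, x]%g == 1%g)
            = #|G|%:R * #|'C_G[a]%g|%:R :> algC.
  rewrite mulr_natr -(sumr_const [in 'C_G[a]%g]).
  rewrite [RHS](eq_bigl (fun x => (x \in G) && (x \in 'C[a]%g))) => [|x].
    rewrite big_mkcondr /=; apply: eq_bigr => x _.
    by rewrite cent1C -(sameP commgP cent1P); case: eqP.
  by rewrite in_setI.
by rewrite card_cent1_unique_nonlin //; ring.
Qed.

(** Pair phi^2 with the regular character in two ways: by its values, supported at 1, and by its
    decomposition into irreducibles. *)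
Lemma cfdot_unique_nonlin_sqr :
  phi 1%g * '[phi * phi, phi] = phi 1%g ^+ 2 - #|G : G^`(1)|%g%:R.
Proof.
have phi_reg : '[phi * phi, cfReg G] = phi 1%g ^+ 2.
  rewrite cfdotE (bigD1 1%g) //= big1 ?addr0 => [|g /andP[_ /negPf g_n1]].
    by rewrite cfRegE eqxx mulr1n conjC_nat mulrCA mulVf ?neq0CG ?mulr1 ?cfunE.
  by rewrite cfRegE g_n1 mulr0n conjC0 mulr0.
(* As [phi] is real and absorbs [xi], one factor [phi] moves to the other side, which gives <phi,
   phi>. *)
have phi_lin xi : xi \is a linear_char -> '[phi * phi, xi] = 1.
  move=> lin_xi; rewrite -[RHS](_ : '[phi, phi] = 1); last first.
    by have /irrP[i ->] := phi_irr; rewrite cfdot_irr eqxx.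
  rewrite !cfdotE; congr (_ * _); apply: eq_bigr => g _.
  rewrite -{4}(lin_mul_unique_nonlin lin_xi) -{2}conj_unique_nonlin !cfunE rmorphM.
  by ring.
rewrite -phi_reg cfReg_sum.
rewrite (sum_Iirr_unique_nonlin (fun chi => chi 1%g *: chi)) cfdotDr cfdot_sumr.
rewrite (eq_bigr (fun=> 1)) => [|i lin_i]; last first.
  by rewrite (lin_char1 lin_i) scale1r phi_lin.
rewrite sumr_const card_lin_irr cfdotZr addrAC subrr add0r.
by rewrite -[in (phi 1%g)^*]conj_unique_nonlin cfunE conjCK.
Qed.

End UniqueNonlinear.

Theorem theorem3p19 (gT : finGroupType) (G : {group gT}) (phi : 'CF(G))
    (p m n : nat)
    (phi_irr : phi \in irr G)
    (phi_nonlin : phi \isn't a linear_char)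
    (phi_uniq : forall chi : 'CF(G),
       chi \in irr G -> chi \isn't a linear_char -> chi = phi)
    (center_triv : 'Z(G)%g = 1%g)
    (p_prime : prime p)
    (m_gt0 : (0 < m)%N)
    (card_G : #|G| = (p ^ m * (p ^ m - 1))%N)
    (card_G' : #|(G^`(1))%g| = (p ^ m)%N)
    (n_ge3 : (3 <= n)%N) :
  Cw n phi =
    #|G|%:R ^+ (n - 1) / #|(G^`(1))%g|%:R
      + #|G|%:R / ((p ^ m)%:R - 1) * Cw (n - 1) phi * ((p ^ m)%:R - 2)
  /\
  zeta G n =
    #|G|%:R ^+ (n - 1) *: (\sum_(i : Iirr G | 'chi_i \is a linear_char) 'chi_i)
      + (#|G|%:R / ((p ^ m)%:R - 1) * Cw n phi) *: phi.
Proof.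
have q_gt1 : (1 < p ^ m)%N by rewrite -{1}(expn0 p) ltn_exp2l ?prime_gt1.
have index_G' : #|G : G^`(1)|%g%:R = (p ^ m)%:R - 1 :> algC.
  by rewrite -divgS ?der_sub // card_G card_G' mulKn ?natrB //; apply: ltnW.
set q : algC := (p ^ m)%:R in index_G' *.
have q_n0 : q != 0 by rewrite pnatr_eq0 -lt0n ltnW.
have q1_n0 : q - 1 != 0 by rewrite subr_eq0 (eqr_nat _ _ 1) neq_ltn q_gt1 orbT.
have G_q : #|G|%:R = q * (q - 1) by rewrite card_G natrM natrB // ltnW.
(* At the identity, [unique_nonlin_der1] gives phi(1)^2 = q(q-1) - (q-1) = (q-1)^2; positivity of
   the degree selects the root. *)
have phi1 : phi 1%g = q - 1.
  have := unique_nonlin_der1 phi_irr phi_nonlin phi_uniq (group1 _).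
  rewrite eqxx mulr1n index_G' G_q => phi1_sq.
  have phi1_ge0 : 0 <= phi 1%g.
    by have /irrP[i ->] := phi_irr; apply/ltW/irr1_gt0.
  apply/eqP; rewrite -(eqrXn2 (isT : 0 < 2)%N) //; last first.
    by rewrite subr_ge0 (ler_nat _ 1) ltnW.
  by apply/eqP; rewrite expr2 phi1_sq; ring.
(* The constant is |G| / phi(1). *)
have cfdot_zeta_phi k :
    '[zeta G k.+2, phi] = #|G|%:R / (q - 1) * Cw k.+2 phi.
  rewrite Cw_zeta // (@cfdot_zeta_commg _ _ _ _ (#|G|%:R / (q - 1))) //.
    move=> a Ga; apply: (mulfI q1_n0); rewrite -{1}phi1.
    by rewrite unique_nonlin_sum_commg //; field.
  by rewrite rpredM ?rpredV ?rpredB ?realn ?real1.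
have zeta_sum k : zeta G k.+2 =
    #|G|%:R ^+ k.+1 *: (\sum_(i : Iirr G | 'chi_i \is a linear_char) 'chi_i)
      + (#|G|%:R / (q - 1) * Cw k.+2 phi) *: phi.
  rewrite [LHS]cfun_sum_cfdot.
  rewrite (sum_Iirr_unique_nonlin phi_irr phi_nonlin phi_uniq
             (fun chi => '[_, chi] *: chi)) cfdot_zeta_phi scaler_sumr.
  congr (_ + _); apply: eq_bigr => i lin_i.
  by rewrite cfdot_zeta_lin.
case: n n_ge3 => [|[|[|k]]] // _; rewrite !subSS !subn0; split=> //.
(* The recursion comes from inserting the expansion of [zeta G k.+2] into <zeta phi, phi>: each
   linear character contributes <phi, phi> = 1, and [phi] contributes <phi^2, phi>. *)
rewrite {1}Cw_zeta // zeta_sum mulrDl cfdotDl -!scalerAl !cfdotZl mulr_suml.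
rewrite cfdot_suml (eq_bigr (fun=> 1)) => [|i lin_i]; last first.
  rewrite (lin_mul_unique_nonlin phi_irr phi_nonlin phi_uniq lin_i).
  by have /irrP[j ->] := phi_irr; rewrite cfdot_irr eqxx.
have -> : '[phi * phi, phi] = q - 2.
  apply: (mulfI q1_n0); rewrite -{1}phi1 cfdot_unique_nonlin_sqr //.
  by rewrite phi1 index_G'; ring.
rewrite sumr_const card_lin_irr index_G' card_G' -/q; congr (_ + _).
(* The q - 1 linear terms give |G|^(k+1) (q-1) = |G|^(k+2) / q, because |G| = q(q-1). *)
by rewrite !exprSr G_q; field.
Qed.
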